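(* Let $\mathcal{A}=\{A_1,\dots,A_m\}$ be a finite set of real $n\times n$ matrices and, for a scalar $\gamma$, let $\mathcal{A}_\gamma=\{\gamma A_1,\dots,\gamma A_m\}$. Consider any path-complete graph $G$ with edges labeled by the matrices in $\mathcal{A}_\gamma$. Suppose that there exist Lyapunov functions $V_1,\dots,V_k$, one per node of $G$, that satisfy the inequalities imposed by the edges of $G$ with $\gamma>1$; that is, for every edge of $G$ from node $i$ to node $j$ with label $\gamma A_l$, one has $V_j(\gamma A_l x)<V_i(x)$ for all $x\in\mathbb{R}^n\setminus\{0\}$. Then one can explicitly write down (from the Lyapunov functions $V_1,\dots,V_k$ and the matrices $A_1,\dots,A_m$) a single Lyapunov function $W(x)$, which is a sum of pointwise maxima of (finitely many) quadratic functions, and which satisfies $$W(A_ix)<W(x)\qquad\text{for all } i\in\{1,\dots,m\}\text{ and all } x\neq 0.$$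
   Context: A Lyapunov function is a function $V:\mathbb{R}^n\to\mathbb{R}$ that is continuous, positive definite ($V(0)=0$ and $V(x)>0$ for all $x\ne0$), and homogeneous (there is $d>0$ with $V(\lambda x)=\lambda^dV(x)$ for all $\lambda>0$). The $V_i$ need not be quadratic. $G$ is a finite directed graph with nodes $1,\dots,k$, each edge of which is labeled by a single matrix of $\mathcal{A}_\gamma$ (equivalently, by a letter $l\in\{1,\dots,m\}$ standing for $\gamma A_l$). The graph $G$ is path-complete if for every finite word $w_1\dots w_t$ over $\{1,\dots,m\}$ of any length $t$ there is a directed path in $G$ such that the word obtained by concatenating the labels of the edges along the path contains $w_1\dots w_t$ as a subword (block of consecutive letters). *)

(* Defs.v *)
From HB Require Import structures.
From mathcomp Require Import all_boot all_order all_algebra.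
From mathcomp Require Import all_classical all_reals all_analysis.
Set Implicit Arguments.
Unset Strict Implicit.
Unset Printing Implicit Defensive.
Import Order.TTheory GRing.Theory Num.Theory.
Import numFieldNormedType.Exports.
Local Open Scope classical_set_scope.
Local Open Scope ring_scope.

Definition homogeneous (R : realType) (n : nat) (V : 'cV[R]_n -> R) : Prop :=
  exists2 d : R, 0 < d &
    forall (a : R) (x : 'cV[R]_n), 0 < a -> V (a *: x) = a `^ d * V x.

Definition positive_definite (R : realType) (n : nat) (V : 'cV[R]_n -> R) :
    Prop :=
  V 0 = 0 /\ forall x, x != 0 -> 0 < V x.

(* The degree of homogeneity may differ from one Lyapunov function to another;
   in particular the functions attached to the nodes of a graph need not share
   a common degree. *)
Definition lyapunov (R : realType) (n : nat) (V : 'cV[R]_n -> R) : Prop :=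
  [/\ continuous V, positive_definite V & homogeneous V].

(* The edge (i, l, j) goes from node i to node j and carries the letter l, which
   stands for the matrix gamma A_l.  Self-loops, and parallel edges with
   different labels, are allowed. *)
Notation edge k m := ('I_k * 'I_m * 'I_k)%type.

Definition source k m (e : edge k m) : 'I_k := e.1.1.
Definition label k m (e : edge k m) : 'I_m := e.1.2.
Definition target k m (e : edge k m) : 'I_k := e.2.

Definition directed_path k m (G : {set edge k m})
    (p : seq (edge k m)) : bool :=
  all [in G] p && sorted (fun e f => target e == source f) p.

Definition path_complete k m (G : {set edge k m}) : Prop :=
  forall w : seq 'I_m,
    exists2 p, directed_path G p & infix w [seq label e | e <- p].

Definition edge_inequalities (R : realType) (n m k : nat)
    (A : 'I_m -> 'M[R]_n) (gamma : R) (G : {set edge k m})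
    (V : 'I_k -> 'cV[R]_n -> R) : Prop :=
  forall (i : 'I_k) (l : 'I_m) (j : 'I_k), (i, l, j) \in G ->
    forall x : 'cV[R]_n, x != 0 -> V j ((gamma *: A l) *m x) < V i x.

Definition quadratic (R : realType) (n : nat) (Q : 'M[R]_n) (x : 'cV[R]_n) : R :=
  (x^T *m Q *m x) 0 0.

(* A pair (Q, Qs) stands for the nonempty finite family Q :: Qs. *)
Definition sum_of_max_of_quadratics (R : realType) (n : nat)
    (W : 'cV[R]_n -> R) : Prop :=
  exists F : seq ('M[R]_n * seq 'M[R]_n),
    forall x, W x =
      \sum_(f <- F) \big[Num.max/quadratic f.1 x]_(Q <- f.2) quadratic Q x.

Definition sqnorm (R : realType) (n : nat) (x : 'cV[R]_n) : R :=
  quadratic 1%:M x.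

(* With r as below, along any path of length r from i to j whose labels spell w,
   V_j (gamma^r A_w x) <= V_i x; hence A_w strictly decreases the Euclidean
   norm of every x != 0. *)
Definition contraction_length (R : realType) (n k : nat) (gamma : R)
    (V : 'I_k -> 'cV[R]_n -> R) (r : nat) : Prop :=
  (0 < r)%N /\
  forall (i j : 'I_k) (x y : 'cV[R]_n), sqnorm x = 1 -> sqnorm y = 1 ->
    V i x < V j (gamma ^+ r *: y).

(* The set has at most one element, so the result is the least r, independently
   of how xget chooses; the default 1 is used only if there is no such r. *)
Definition least_contraction_length (R : realType) (n k : nat) (gamma : R)
    (V : 'I_k -> 'cV[R]_n -> R) : nat :=
  xget 1%N [set r | contraction_length gamma V r /\
                    forall s, contraction_length gamma V s -> (r <= s)%N].

Definition word_product (R : realType) (n m : nat) (A : 'I_m -> 'M[R]_n)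
    (w : seq 'I_m) : 'M[R]_n :=
  \big[mulmx/1%:M]_(l <- w) A l.

(* W(x) = sum_{t < r} max_{|w| = t} |A_w x|^2, where r is read off from the V_i.
   The maximum runs over all words of length t, so the order in which the
   letters of a word are multiplied is immaterial; the default 0 of the maximum
   is reached only by nonnegative terms or, if m = 0, by the empty family. *)
Definition explicit_lyapunov (R : realType) (n m k : nat)
    (A : 'I_m -> 'M[R]_n) (gamma : R) (V : 'I_k -> 'cV[R]_n -> R)
    (x : 'cV[R]_n) : R :=
  \sum_(t < least_contraction_length gamma V)
    \big[Num.max/0]_(w : t.-tuple 'I_m) sqnorm (word_product A w *m x).

(* Main.v *)
Require Import Defs.
From HB Require Import structures.
From mathcomp Require Import all_boot all_order all_algebra.
From mathcomp Require Import all_classical all_reals all_analysis.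
From mathcomp Require Import lra.
Set Implicit Arguments.
Unset Strict Implicit.
Unset Printing Implicit Defensive.
Import Order.TTheory GRing.Theory Num.Theory.
Import numFieldNormedType.Exports.
Local Open Scope classical_set_scope.
Local Open Scope ring_scope.

(** By homogeneity and compactness of the unit sphere, [V_j (gamma^r y)] exceeds
    [V_i x] for all unit vectors [x], [y] and all [i], [j] once [r] is large, so
    a contraction length [r] exists.  By path-completeness every word of length
    [r] is read along some path of the graph, say from [i] to [j]; chaining the
    edge inequalities gives [V_j (gamma^r A_w x) <= V_i x], which forces
    [|A_w x| < |x|] for [x != 0].  With
    [f_t x = max_{|w| = t} |A_w x|^2] we have [f_t (A_i x) <= f_{t+1} x],
    so the sum [W = sum_{t < r} f_t] telescopes:
    [W (A_i x) - W x <= f_r x - f_0 x < 0]. *)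

Lemma continuous_sumr (R : realType) (T : topologicalType) (I : Type)
    (s : seq I) (F : I -> T -> R) :
  (forall i, continuous (F i)) -> continuous (fun x => \sum_(i <- s) F i x).
Proof.
move=> cF; apply: (@continuous_big R I +%R 0 xpredT) => [|i _]; last exact: cF.
by move=> z; apply: cvgD; [exact: cvg_fst|exact: cvg_snd].
Qed.

(** * Quadratic forms and the compact Euclidean unit sphere *)

Section Quadratic.
Variables (R : realType) (n : nat).
Implicit Types (x : 'cV[R]_n) (M Q : 'M[R]_n).

Lemma quadratic_sum Q x :
  quadratic Q x = \sum_j (\sum_i x i 0 * Q i j) * x j 0.
Proof.
rewrite /quadratic mxE; apply: eq_bigr => j _; rewrite mxE.
by congr (_ * _); apply: eq_bigr => i _; rewrite mxE.
Qed.

Lemma continuous_quadratic Q : continuous (quadratic Q).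
Proof.
have c j : continuous (fun x : 'cV[R]_n => \sum_i x i 0 * Q i j).
  apply: continuous_sumr => i x.
  by apply: (@cvgM _ _ (nbhs x)); [exact: (@coord_continuous R)|exact: cvg_cst].
have -> : quadratic Q = fun x => \sum_j (\sum_i x i 0 * Q i j) * x j 0.
  by apply/funext => x; rewrite quadratic_sum.
apply: continuous_sumr => j x.
by apply: (@cvgM _ _ (nbhs x)); [exact: c|exact: (@coord_continuous R)].
Qed.

Lemma sqnorm_sum x : sqnorm x = \sum_i x i 0 ^+ 2.
Proof.
by rewrite /sqnorm /quadratic mulmx1 mxE; apply: eq_bigr => i _; rewrite mxE.
Qed.

Lemma sqnorm_mulmx M x : sqnorm (M *m x) = quadratic (M^T *m M) x.
Proof. by rewrite /sqnorm /quadratic trmx_mul mulmx1 !mulmxA. Qed.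

Lemma sqnormZ (a : R) x : sqnorm (a *: x) = a ^+ 2 * sqnorm x.
Proof.
by rewrite !sqnorm_sum mulr_sumr; apply: eq_bigr => i _; rewrite mxE exprMn.
Qed.

Lemma sqnorm_ge0 x : 0 <= sqnorm x.
Proof. by rewrite sqnorm_sum sumr_ge0 // => i _; exact: sqr_ge0. Qed.

Lemma sqnorm0 : sqnorm (0 : 'cV[R]_n) = 0.
Proof. by rewrite -(scale0r 0) sqnormZ expr0n mul0r. Qed.

Lemma sqnorm_eq0 x : sqnorm x = 0 -> x = 0.
Proof.
rewrite sqnorm_sum => /psumr_eq0P x0; apply/colP => i; rewrite mxE.
by apply/eqP; rewrite -sqrf_eq0 x0 // => j _; exact: sqr_ge0.
Qed.

Lemma sqnorm_gt0 x : x != 0 -> 0 < sqnorm x.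
Proof.
move=> x0; rewrite lt_def sqnorm_ge0 andbT.
by apply: contra_neq x0 => /sqnorm_eq0.
Qed.

Lemma sqnorm_normalize x :
  x != 0 -> sqnorm ((Num.sqrt (sqnorm x))^-1 *: x) = 1.
Proof.
move=> /sqnorm_gt0 x0.
by rewrite sqnormZ exprVn sqr_sqrtr ?(ltW x0) // mulVf // gt_eqF.
Qed.

(** Heine-Borel is applied to row vectors, and the result is carried over to columns by the
    continuous map [trmx]. *)
Lemma compact_sphere : compact [set x : 'cV[R]_n | sqnorm x = 1].
Proof.
have ct : continuous (trmx : 'rV[R]_n -> 'cV[R]_n).
  move=> u s /= /nbhs_ballP[e e0 es]; apply/nbhs_ballP.
  exists e => //= v [_ uv]; apply: es; split=> // i j; rewrite !mxE; exact: uv.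
have -> : [set x : 'cV[R]_n | sqnorm x = 1] =
    (@trmx R 1 n) @` [set u : 'rV[R]_n | sqnorm u^T = 1].
  rewrite predeqE => x; split=> [x1|[u u1 <-]//].
  by exists x^T => /=; rewrite trmxK.
apply: continuous_compact.
  by apply: continuous_subspaceT; exact: ct.
apply: bounded_closed_compact.
  exists 1; split=> // M M1 u /= u1; apply: le_trans (ltW M1).
  rewrite /Num.Def.normr /= mx_normrE bigmax_le // => -[i j] _ /=.
  (* A single squared coordinate is at most the sum of all of them, which is 1. *)
  rewrite -(@expr_le1 _ 2) // real_normK ?num_real // -u1 sqnorm_sum.
  rewrite (bigD1 j) //= ord1 mxE lerDl sumr_ge0 // => l _; exact: sqr_ge0.
apply: (@preimage_closed _ _ (fun u : 'rV[R]_n => sqnorm u^T) [set 1]).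
  move=> u _; apply: continuous_comp; first exact: ct.
  exact: continuous_quadratic.
exact: closed_eq.
Qed.

Lemma sphere_bounds (f : 'cV[R]_n -> R) :
  continuous f -> (forall x, sqnorm x = 1 -> 0 < f x) ->
  exists a b, 0 < a /\ forall x, sqnorm x = 1 -> a <= f x <= b.
Proof.
pose S := [set x : 'cV[R]_n | sqnorm x = 1] => cf f0.
have cfS : {within S, continuous f} by exact: continuous_subspaceT.
have [S0|/set0P/negP/negPn/eqP S0] := pselect (S !=set0).
  have [a Sa fa] := compact_EVT_min S0 compact_sphere cfS.
  have [b Sb fb] := compact_EVT_max S0 compact_sphere cfS.
  exists (f a), (f b); split; first by apply: f0; exact: set_mem Sa.
  by move=> x x1; rewrite fa ?fb // inE.
(* The sphere is empty (this is the case [n = 0]), so any bounds with [0 < a] will do. *)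
exists 1, 1; split=> // x x1.
by have : S x := x1; rewrite S0.
Qed.

End Quadratic.

Lemma expr_unbounded (R : realType) (g c : R) :
  1 < g -> exists N, forall r, (N <= r)%N -> c < g ^+ r.
Proof.
move=> g1; have g0 : 0 < g - 1 by rewrite subr_gt0.
exists (Num.bound `|c / (g - 1)|) => r Nr.
(* Bernoulli's inequality; the Archimedean property then supplies the threshold. *)
have bern (s : nat) : 1 + s%:R * (g - 1) <= g ^+ s.
  elim: s => [|s IHs]; first by rewrite mul0r addr0 expr0.
  rewrite exprS; apply: le_trans (ler_wpM2l (ltW (lt_trans ltr01 g1)) IHs).
  have : 0 <= s%:R * (g - 1) * (g - 1) by rewrite !mulr_ge0 // ltW.
  rewrite -natr1; lra.
apply: lt_le_trans (bern r); rewrite ltr_pwDl //.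
rewrite -ler_pdivrMr //; apply: le_trans (ler_norm _) _.
by apply/ltW/(lt_le_trans (archi_boundP (normr_ge0 _))); rewrite ler_nat.
Qed.

(** * Existence of a contraction length *)

Section Contraction.
Variables (R : realType) (n k : nat) (gamma : R) (V : 'I_k -> 'cV[R]_n -> R).
Hypotheses (gamma1 : 1 < gamma) (lyapV : forall i, lyapunov (V i)).

Lemma lyapunov_sphere_gt0 i x : sqnorm x = 1 -> 0 < V i x.
Proof.
have [_ [_ pV] _] := lyapV i => x1; apply: pV; apply/eqP => x0.
by move/eqP: x1; rewrite x0 sqnorm0 eq_sym oner_eq0.
Qed.

Lemma contraction_pair i j : exists N, forall r, (N <= r)%N ->
  forall x y, sqnorm x = 1 -> sqnorm y = 1 -> V i x < V j (gamma ^+ r *: y).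
Proof.
have [ci _ _] := lyapV i; have [cj _ [d d0 Vj]] := lyapV j.
have [? [b [_ Hb]]] := sphere_bounds ci (@lyapunov_sphere_gt0 i).
have [a [? [a0 Ha]]] := sphere_bounds cj (@lyapunov_sphere_gt0 j).
pose c := (`|b| / a + 1) `^ d^-1.
have [N HN] := expr_unbounded c gamma1.
exists N => r Nr x y x1 y1.
have /andP[_ xb] := Hb x x1; have /andP[ya _] := Ha y y1.
have g0 : 0 < gamma ^+ r by rewrite exprn_gt0 // (lt_trans _ gamma1).
have ba0 : 0 <= `|b| / a + 1 by rewrite addr_ge0 // divr_ge0 // ltW.
have cg : `|b| / a + 1 < (gamma ^+ r) `^ d.
  have : c `^ d < (gamma ^+ r) `^ d.
    by rewrite gt0_ltr_powR ?HN ?nnegrE ?powR_ge0 // ltW.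
  by rewrite /c -powRrM mulVf ?lt0r_neq0 // powRr1.
rewrite Vj //; apply: (le_lt_trans xb); apply: (le_lt_trans (ler_norm b)).
apply: (@lt_le_trans _ _ ((gamma ^+ r) `^ d * a)).
  rewrite -ltr_pdivrMr //.
  by apply: le_lt_trans cg; rewrite lerDl.
by rewrite ler_wpM2l // powR_ge0.
Qed.

Lemma contraction_length_exists : exists r, contraction_length gamma V r.
Proof.
have /choice[N HN] : forall p : 'I_k * 'I_k, exists N, forall r, (N <= r)%N ->
    forall x y, sqnorm x = 1 -> sqnorm y = 1 ->
    V p.1 x < V p.2 (gamma ^+ r *: y).
  by move=> [i j]; exact: contraction_pair.
(* One threshold for all pairs of nodes; the successor makes it positive. *)
exists (\max_p N p).+1; split=> // i j x y; apply: (HN (i, j)).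
by apply: leqW; exact: leq_bigmax.
Qed.

(** Well-ordering of the naturals yields a least contraction length, so [xget] does not fall back on
    its default. *)
Lemma least_contraction_lengthP :
  contraction_length gamma V (least_contraction_length gamma V).
Proof.
have ex : exists r, `[< contraction_length gamma V r >].
  by have [r Hr] := contraction_length_exists; exists r; apply/asboolP.
rewrite /least_contraction_length.
set P := [set r | _]; suff /(xgetPex 1%N) [] : exists r, P r by [].
exists (ex_minn ex); case: ex_minnP => r /asboolP Hr minr; split=> // s Hs.
by apply: minr; apply/asboolP.
Qed.

(** * From edges to paths, and from paths to words *)

Variables (m : nat) (A : 'I_m -> 'M[R]_n) (G : {set edge k m}).
Hypothesis hE : edge_inequalities A gamma G V.

Lemma word_product_rcons (w : seq 'I_m) (l : 'I_m) :
  word_product A (rcons w l) = word_product A w *m A l.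
Proof.
rewrite /word_product; elim: w => [|l' w IHw].
  by rewrite /= big_cons !big_nil mulmx1 mul1mx.
by rewrite /= !big_cons IHw mulmxA.
Qed.

(** The weak inequality also covers [x = 0], which can arise along a path when a matrix is
    singular. *)
Lemma edge_le e x : e \in G ->
  V (target e) ((gamma *: A (label e)) *m x) <= V (source e) x.
Proof.
case: e => [[i l] j] eG; have [->|x0] := eqVneq x 0; last exact/ltW/hE.
have [_ [Vi0 _] _] := lyapV i; have [_ [Vj0 _] _] := lyapV j.
by rewrite mulmx0 /source /target /= Vi0 Vj0.
Qed.

(* The letters read along a path act on vectors in the order of the path, while
   [word_product] applies its last letter first, hence the reversal. *)
Lemma path_le e p x : directed_path G (e :: p) ->
  V (target (last e p)) (gamma ^+ (size p).+1 *:
    (word_product A (rev [seq label f | f <- e :: p]) *m x)) <=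
  V (source e) x.
Proof.
elim: p e x => [|f p IHp] e x /andP[].
  rewrite /= andbT => eG _.
  by rewrite /word_product big_cons big_nil mulmx1 expr1 scalemxAl edge_le.
move=> /= /andP[eG pG] /andP[/eqP ef pp].
apply: le_trans (edge_le x eG).
have := IHp f ((gamma *: A (label e)) *m x).
rewrite /directed_path /= pG pp => /(_ isT).
rewrite ef [rev (label e :: _)]rev_cons word_product_rcons.
by rewrite [gamma ^+ _.+2]exprSr -scalerA -scalemxAl -!scalemxAr mulmxA.
Qed.

Hypothesis hG : path_complete G.

Lemma word_le w : w != [::] -> exists i j, forall x,
  V j (gamma ^+ size w *: (word_product A w *m x)) <= V i x.
Proof.
move=> w0; have [p pG /infixP[u [v puv]]] := hG (rev w).
(* The factor of the path that reads exactly [rev w]; it has a first edge, hence a source, because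
   [w] is nonempty. *)
have lw : [seq label e | e <- take (size w) (drop (size u) p)] = rev w.
  by rewrite map_take map_drop puv drop_size_cat // take_size_cat ?size_rev.
have : directed_path G (take (size w) (drop (size u) p)).
  have /andP[aG sp] := pG; apply/andP; split.
    by apply/allP => e /mem_take /mem_drop; exact: (allP aG).
  exact: take_sorted (drop_sorted _ _).
case: (take _ _) lw => [|e q] lw qG.
  by move/(congr1 size)/esym/eqP: lw; rewrite size_rev size_eq0 (negPf w0).
exists (source e), (target (last e q)) => x.
have := path_le x qG; rewrite lw revK.
by have /(congr1 size) := lw; rewrite size_rev size_map /= => ->.
Qed.

(** Suppose [y = A_w x] has norm [t] at least the norm [s] of [x]. Since [t / s >= 1], homogeneity
    gives [V_j (gamma^r y / t) <= V_j (gamma^r y / s) <= V_i (x / s)], against the contraction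
    property at the unit vectors [x / s] and [y / t]. *)
Lemma sqnorm_word_lt w x : contraction_length gamma V (size w) -> x != 0 ->
  sqnorm (word_product A w *m x) < sqnorm x.
Proof.
move=> [w0 Hw] x0; have [|i [j Vw]] := @word_le w.
  by rewrite -size_eq0 -lt0n.
rewrite ltNge; apply/negP => xy; set y := _ *m x in xy.
have sx0 : 0 < sqnorm x by exact: sqnorm_gt0.
have sy0 : 0 < sqnorm y by exact: lt_le_trans xy.
have y0 : y != 0 by apply: contraTneq sy0 => ->; rewrite sqnorm0 ltxx.
pose s := Num.sqrt (sqnorm x); pose t := Num.sqrt (sqnorm y).
have s0 : 0 < s by rewrite sqrtr_gt0.
have t0 : 0 < t by rewrite sqrtr_gt0.
have := Hw i j _ _ (sqnorm_normalize x0) (sqnorm_normalize y0).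
rewrite ltNge => /negP; apply; apply: le_trans (Vw _).
have [_ [Vj0 Vjp] [d d0 Vj]] := lyapV j.
rewrite -scalemxAr -/y -/s -/t.
have -> : gamma ^+ size w *: (s^-1 *: y) =
    (t / s) *: (gamma ^+ size w *: (t^-1 *: y)).
  rewrite !scalerA; congr (_ *: _).
  by rewrite mulrAC [t / s / t]mulrAC mulfV ?lt0r_neq0 // mul1r mulrC.
rewrite (Vj (t / s)) ?divr_gt0 // ler_peMl //.
  apply/ltW/Vjp; rewrite !scaler_eq0 !negb_or y0 invr_eq0 !lt0r_neq0 //.
  by rewrite exprn_gt0 // (lt_trans _ gamma1).
suff : 1 `^ d <= (t / s) `^ d by rewrite powR1.
rewrite ge0_ler_powR ?(ltW d0) ?nnegrE ?divr_ge0 ?(ltW s0) ?(ltW t0) //.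
by rewrite ler_pdivlMr // mul1r ler_wsqrtr.
Qed.

End Contraction.

Theorem theorem5 (R : realType) (n m k : nat) (A : 'I_m -> 'M[R]_n)
    (gamma : R) (G : {set edge k m})
    (V : 'I_k -> 'cV[R]_n -> R)
    (hG : path_complete G)
    (hgamma : 1 < gamma)
    (hV : forall i, lyapunov (V i))
    (hE : edge_inequalities A gamma G V) :
  let W := explicit_lyapunov A gamma V in
  [/\ lyapunov W,
      sum_of_max_of_quadratics W &
      forall (i : 'I_m) (x : 'cV[R]_n), x != 0 -> W (A i *m x) < W x].
Proof.
move=> W.
have [r0 _] := least_contraction_lengthP hgamma hV.
have Hr := least_contraction_lengthP hgamma hV.
set r := least_contraction_length gamma V in r0 Hr.
pose f x t :=
  \big[Num.max/0]_(w : t.-tuple 'I_m) sqnorm (word_product A w *m x).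
have WE x : W x = \sum_(t < r) f x t by [].
have f_ge0 x t : 0 <= f x t by exact: bigmax_ge_id.
have f0_ge x : sqnorm x <= f x 0%N.
  apply: (bigmax_sup [tuple]) => //=.
  by rewrite /word_product big_nil mul1mx.
split.
- split.
  + have -> : W = fun x => \sum_(t < r) f x t by [].
    apply: (@continuous_sumr R _ _ _ (fun (t : 'I_r) x => f x t)) => t.
    apply: (@continuous_big _ _ _ _ _ (@max_continuous _ R)) => w _.
    under eq_fun do rewrite sqnorm_mulmx.
    exact: continuous_quadratic.
  (* Positivity comes from the term [t = 0], present because [0 < r]. *)
  + split=> [|x x0].
      rewrite WE big1 // => t _; apply: big1_idem => [|w _]; first exact: maxxx.
      by rewrite mulmx0 sqnorm0.
    apply: (lt_le_trans (sqnorm_gt0 x0)); apply: le_trans (f0_ge x) _.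
    by rewrite WE (bigD1 (Ordinal r0)) //= lerDl sumr_ge0.
  (* The degree is 2 whatever the degrees of the [V i]; multiplication by [a ^+ 2 >= 0] commutes
     with the maximum. *)
  + exists 2 => // a x a0; rewrite !WE mulr_sumr; apply: eq_bigr => t _.
    rewrite powR_mulrn ?(ltW a0) // /f.
    rewrite (big_endo (fun z => a ^+ 2 * z)) ?mulr0 //; last first.
      by move=> y z; rewrite maxr_pMr // sqr_ge0.
    by apply: eq_bigr => w _; rewrite -scalemxAr sqnormZ.
(* The zero matrix heading each family plays the part of the default 0 of the maximum. *)
- exists [seq (0, [seq (word_product A (val w))^T *m word_product A (val w)
                  | w <- index_enum (t.-tuple 'I_m)]) | t <- iota 0 r] => x.
  rewrite WE big_map -[r in iota 0 r]subn0 -/(index_iota 0 r) big_mkord.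
  apply: eq_bigr => t _ /=; rewrite big_map /f.
  have -> : quadratic 0 x = 0 by rewrite /quadratic mulmx0 mul0mx mxE.
  by apply: eq_bigr => w _; rewrite sqnorm_mulmx.
- move=> i x x0.
  (* Appending [i] to a word of length [t] gives one of the words of length [t.+1]. *)
  have step t : f (A i *m x) t <= f x t.+1.
    apply/bigmax_leP; split=> // w _.
    apply: (bigmax_sup [tuple of rcons w i]) => //=.
    by rewrite word_product_rcons mulmxA.
  rewrite !WE; apply: (@le_lt_trans _ _ (\sum_(t < r) f x t.+1)).
    by apply: ler_sum => t _; exact: step.
  (* Adding [f x 0] to both sides completes the shifted sum and reduces the goal to
     [f x r < f x 0]. *)
  rewrite -(ltrD2l (f x 0%N)).
  have -> : f x 0%N + \sum_(t < r) f x t.+1 = \sum_(t < r.+1) f x t.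
    by rewrite big_ord_recl.
  rewrite big_ord_recr /= addrC ltrD2r.
  apply: lt_le_trans (f0_ge x); apply: bigmax_lt; first exact: sqnorm_gt0.
  by move=> w _; apply: (sqnorm_word_lt hgamma hV hE hG); rewrite ?size_tuple.
Qed.
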